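(* Let $A$ be an $n\times n$ nonzero doubly nonnegative matrix with Hadamard power rank $\mathrm{Hrk}(A)$, and let $r$ be a positive real number. If $r>\mathrm{Hrk}(A)-2$, then the rank of $A^{\circ r}$ is $\mathrm{Hrk}(A)$.
   Context: An $n\times n$ matrix is doubly nonnegative if it is positive semidefinite (real symmetric) and all its entries are nonnegative. For a matrix $A=[a_{ij}]$ with nonnegative entries, $A^{\circ r}=[a_{ij}^r]$ is its $r$th Hadamard (entrywise) power. The Hadamard power rank $\mathrm{Hrk}(A)$ of a nonzero $m\times n$ matrix $A$ is the largest integer $k$ for which there is a list of $k$ distinct columns of $A$ such that no column in the list is a scalar multiple of any other column in the list; the Hadamard power rank of the zero matrix is $0$. *)

(* Defs.v *)
From HB Require Import structures.
From mathcomp Require Import all_boot all_order all_algebra.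
From mathcomp Require Import boolp reals exp.

Set Implicit Arguments.
Unset Strict Implicit.
Unset Printing Implicit Defensive.

Import Order.TTheory GRing.Theory Num.Theory.
Local Open Scope ring_scope.

Definition psdmx (R : realType) (n : nat) (A : 'M[R]_n) : Prop :=
  A \is symmetricmx /\ forall x : 'cV[R]_n, 0 <= (x^T *m A *m x) 0 0.

Definition doubly_nonnegative (R : realType) (n : nat) (A : 'M[R]_n) : Prop :=
  psdmx A /\ forall i j, 0 <= A i j.

(* Since [powR] satisfies 0 `^ r = 0 for r != 0, zero entries stay zero
   whenever the exponent is positive. *)
Definition hadamard_power (R : realType) (m n : nat) (r : R)
    (A : 'M[R]_(m, n)) : 'M[R]_(m, n) :=
  \matrix_(i < m, j < n) (A i j `^ r).

Definition scalar_multiple (R : realType) (m : nat) (u v : 'cV[R]_m) : Prop :=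
  exists c : R, u = c *: v.

(* A list of distinct columns is encoded by the set of its indices; columns at
   different positions that are equal as vectors are excluded by c = 1. *)
Definition pairwise_nonmultiple_cols (R : realType) (m n : nat)
    (A : 'M[R]_(m, n)) (S : {set 'I_n}) : Prop :=
  forall i j, i \in S -> j \in S -> i != j ->
    ~ scalar_multiple (col i A) (col j A).

(* The zero matrix needs its own case: a single zero column satisfies
   [pairwise_nonmultiple_cols] vacuously. *)
Definition Hrk (R : realType) (m n : nat) (A : 'M[R]_(m, n)) : nat :=
  if A == 0 then 0%N
  else \max_(S : {set 'I_n} | `[< pairwise_nonmultiple_cols A S >]) #|S|.

(* Main.v *)
Require Import Defs.
From HB Require Import structures.
From mathcomp Require Import all_boot all_order all_algebra.
From mathcomp Require Import ring lra.
From mathcomp Require Import functions topology normedtype derive realfun.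
From mathcomp Require Import boolp reals exp.

Import Order.TTheory GRing.Theory Num.Theory.
Import numFieldNormedType.Exports.
Local Open Scope ring_scope.

(* Keep k = Hrk(A) pairwise non-proportional nonzero columns; every other column
   is a nonnegative multiple of one of them, which bounds the rank of A^{o r}
   by k. For the converse, the corresponding principal submatrix C has positive
   2x2 principal minors, and C^{o r} is positive definite for r > k - 2, by the
   induction of FitzGerald and Horn: with z z^T the rank-one kernel agreeing
   with C on row k and M_t = t C + (1 - t) z z^T, the form x^T M_t^{o r} x has
   derivative r x^T ((C - z z^T) o M_t^{o (r-1)}) x, which is positive on ]0, 1[
   by the Schur product theorem and the induction hypothesis in size k - 1,
   because row k of C - z z^T vanishes; at t = 0 the form is a square. *)

(** * Positive semidefinite kernels and Schur complements *)

Definition qform {R : realType} {I : finType} (C : I -> I -> R) (x : I -> R) : R :=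
  \sum_i \sum_j x i * x j * C i j.

Definition psd_kernel {R : realType} {I : finType} (C : I -> I -> R) : Prop :=
  (forall i j, C i j = C j i) /\ forall x, 0 <= qform C x.

(** The Schur complement stays on the full index type: for symmetric [C] with nonzero pivot, row and
    column [k] become zero instead of being removed. *)
Definition schur {R : realType} {I : finType} (k : I) (C : I -> I -> R) (i j : I) : R :=
  C i j - C i k * C j k / C k k.

Lemma eq_qform {R : realType} {I : finType} {C : I -> I -> R} D {x} y :
  (forall i j, x i * x j * C i j = y i * y j * D i j) -> qform C x = qform D y.
Proof. by move=> e; do 2 apply: eq_bigr => ? _; rewrite e. Qed.

Lemma sum_delta {R : realType} {I : finType} (k : I) (F : I -> R) :
  \sum_i (i == k)%:R * F i = F k.
Proof.
rewrite (bigD1 k) //= eqxx mul1r big1 ?addr0 // => i /negbTE ->.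
by rewrite mul0r.
Qed.

Lemma qform_rank1 {R : realType} {I : finType} (v x : I -> R) :
  qform (fun i j => v i * v j) x = (\sum_i x i * v i) ^+ 2.
Proof.
rewrite expr2 big_distrlr /=; do 2 apply: eq_bigr => ? _; ring.
Qed.

Lemma qform0 {R : realType} {I : finType} (C : I -> I -> R) : qform C (fun=> 0) = 0.
Proof. by rewrite /qform big1 // => i _; rewrite big1 // => j _; rewrite !mul0r. Qed.

Lemma qform_shift {R : realType} {I : finType} (C : I -> I -> R) (y : I -> R) k a :
  (forall i j, C i j = C j i) ->
  qform C (fun l => y l + a * (l == k)%:R) =
  qform C y + 2 * a * (\sum_l y l * C l k) + a ^+ 2 * C k k.
Proof.
move=> sC.
have -> : qform C (fun l => y l + a * (l == k)%:R) =
  qform C y + (\sum_i \sum_j (j == k)%:R * (a * y i * C i j) +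
  \sum_i (i == k)%:R * \sum_j (a * y j * C j i)) +
  \sum_i (i == k)%:R * \sum_j (j == k)%:R * (a ^+ 2 * C i j).
  rewrite /qform -!big_split /=; apply: eq_bigr => i _.
  rewrite !mulr_sumr -!big_split /=; apply: eq_bigr => j _.
  rewrite (sC j i); ring.
rewrite !sum_delta; under eq_bigr do rewrite sum_delta.
rewrite -big_split mulr_sumr /=; congr (_ + _ + _); apply: eq_bigr => i _; ring.
Qed.

Lemma psd_diag_ge0 {R : realType} {I : finType} (C : I -> I -> R) :
  psd_kernel C -> forall k, 0 <= C k k.
Proof.
move=> [sC pC] k; have := pC (fun l => 0 + 1 * (l == k)%:R).
rewrite (qform_shift _ (fun=> 0)) // qform0 big1 => [|i _]; last by rewrite mul0r.
by rewrite mulr0 !add0r expr1n mul1r.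
Qed.

(** With [C k k = 0] the form is affine in the coefficient of index [k], so a nonzero slope would
    make it negative somewhere. *)
Lemma psd_diag0 {R : realType} {I : finType} (C : I -> I -> R) :
  psd_kernel C -> forall k j, C k k = 0 -> C j k = 0.
Proof.
move=> [sC pC] k j C0; apply/eqP/negP => /negP n0.
set y := fun l => (l == j)%:R : R.
(* This coefficient gives the form the value -1. *)
have := pC (fun l => y l + - ((qform C y + 1) / (2 * C j k)) * (l == k)%:R).
rewrite (qform_shift _ y) // C0 mulr0 addr0 sum_delta.
have -> : 2 * - ((qform C y + 1) / (2 * C j k)) * C j k = - (qform C y + 1).
  by field.
lra.
Qed.

Lemma qform_schur {R : realType} {I : finType} (C : I -> I -> R) k x :
  qform (schur k C) x = qform C x - (\sum_i x i * C i k) ^+ 2 / C k k.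
Proof.
rewrite expr2 big_distrlr /= mulr_suml -sumrB; apply: eq_bigr => i _.
rewrite mulr_suml -sumrB; apply: eq_bigr => j _; rewrite /schur; ring.
Qed.

(** Completing the square: the Schur form at [x] is the minimum of the form of [C] over shifts of
    [x] along index [k]. *)
Lemma psd_schur {R : realType} {I : finType} (C : I -> I -> R) k :
  psd_kernel C -> C k k != 0 -> psd_kernel (schur k C).
Proof.
move=> [sC pC] k0; split=> [i j|x]; first by rewrite /schur (sC i j) [C i k * _]mulrC.
have := pC (fun l => x l + - ((\sum_i x i * C i k) / C k k) * (l == k)%:R).
rewrite qform_shift // qform_schur; congr (_ <= _); by field.
Qed.

Lemma schur_row0 {R : realType} {I : finType} (C : I -> I -> R) k j :
  (forall i j, C i j = C j i) -> C k k != 0 -> schur k C k j = 0.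
Proof. by move=> sC k0; rewrite /schur (sC k j); field. Qed.

(** Cholesky elimination, by induction on a list of indices outside which the rows vanish. A zero
    pivot has a zero row; a positive one splits off a rank-one term. *)
Lemma psd_gram {R : realType} {I : finType} (C : I -> I -> R) : psd_kernel C ->
  exists ws : seq (I -> R), forall i j, C i j = \sum_(w <- ws) w i * w j.
Proof.
move=> pC; have : forall i, i \notin enum I -> forall j, C i j = 0.
  by move=> i; rewrite mem_enum.
elim: (enum I) C pC => [|k s IHs] C pC s0.
  by exists [::] => i j; rewrite big_nil s0.
have [C0|C0] := eqVneq (C k k) 0.
  apply: IHs => // i is_ j; have [->|ik] := eqVneq i k.
    by rewrite pC.1; apply: psd_diag0.
  by apply: s0; rewrite inE negb_or ik.
have [|i is_ j|ws e] := IHs (schur k C); first exact: psd_schur.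
  have [->|ik] := eqVneq i k; first by rewrite schur_row0 //; apply: pC.1.
  have Ci0 l : C i l = 0 by apply: s0; rewrite inE negb_or ik.
  by rewrite /schur !Ci0 !mul0r subrr.
exists ((fun i => C i k / Num.sqrt (C k k)) :: ws) => i j.
rewrite big_cons -e /schur mulrACA -invfM -expr2 sqr_sqrtr; last exact: psd_diag_ge0.
by rewrite addrC subrK.
Qed.

(** Writing [D] as a sum of [w w^T] turns the form into a sum of forms of [P] at the products [x w].
    All are nonnegative, and [0 < D k k] forces some [w k != 0], whose term is positive. *)
Lemma schur_product_gt0 {R : realType} {I : finType} (T : {set I}) (D P : I -> I -> R) :
  psd_kernel D ->
  (forall x, (forall i, i \notin T -> x i = 0) -> (exists i, x i != 0) -> 0 < qform P x) ->
  forall x, (forall i, i \notin T -> x i = 0) -> (exists i, x i != 0 /\ 0 < D i i) ->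
  0 < qform (fun i j => D i j * P i j) x.
Proof.
move=> /psd_gram[ws De] Ppos x xT [k [xk Dk]].
have -> : qform (fun i j => D i j * P i j) x =
    \sum_(w <- ws) qform P (fun i => x i * w i).
  rewrite /qform [RHS]exchange_big /=; apply: eq_bigr => i _.
  rewrite [RHS]exchange_big /=; apply: eq_bigr => j _.
  rewrite De mulr_suml mulr_sumr; apply: eq_bigr => w _; ring.
have Pw w : w k != 0 -> 0 < qform P (fun i => x i * w i).
  move=> wk; apply: Ppos => [i /xT ->|]; first by rewrite mul0r.
  by exists k; rewrite mulf_neq0.
have Pge w : 0 <= qform P (fun i => x i * w i).
  have [[i xi]|/forallNP x0] := pselect (exists i, x i * w i != 0).
    apply/ltW/Ppos; last by exists i.
    by move=> l /xT ->; rewrite mul0r.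
  rewrite (@eq_qform _ _ _ P _ (fun=> 0)) ?qform0 // => i j.
  by have /negP/negPn/eqP -> := x0 i; rewrite !mul0r.
move: Dk; rewrite De {De}; elim: ws => [|w ws IH]; first by rewrite !big_nil ltxx.
rewrite !big_cons => Dk; have [w0|w0] := eqVneq (w k) 0.
  by apply: ltr_wpDl => //; apply: IH; rewrite w0 mul0r add0r in Dk.
by apply: ltr_pwDl; [apply: Pw | apply: sumr_ge0].
Qed.

(** * The segment between two kernels: calculus and definiteness of powers *)

Lemma is_derive_bigsum {R : realType} {I : finType} (h : I -> R -> R) (dh : I -> R) (t : R) :
  (forall i, is_derive t 1 (h i) (dh i)) ->
  is_derive t 1 (fun u => \sum_i h i u) (\sum_i dh i).
Proof.
move=> hd; rewrite (_ : (fun _ => _) = \sum_i h i); last by apply/funext => u; rewrite fct_sumE.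
by elim/big_ind2 : _ => // [|f a g b] *; [exact: is_derive_cst|exact: is_deriveD].
Qed.

Lemma norm_powR_continuous {R : realType} (r : R) : 0 < r ->
  continuous (fun u : R => `|u| `^ r).
Proof.
move=> r0 u; have [->|u0] := eqVneq u 0.
  apply/cvgrPdist_lt => e e0 /=; near=> v.
  rewrite normr0 powR0 ?gt_eqF // sub0r normrN ger0_norm ?powR_ge0 //.
  have -> : e = (e `^ r^-1) `^ r by rewrite -powRrM mulVf ?gt_eqF // powRr1 // ltW.
  apply: gt0_ltr_powR; rewrite ?nnegrE ?powR_ge0 //.
  near: v; apply: (@nbhs0_lt R R); exact: powR_gt0.
apply: (@continuous_comp _ _ _ (@Num.norm _ R) (fun v => v `^ r)); first exact: norm_continuous.
apply: differentiable_continuous; apply/derivable1_diffP.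
by apply: derivable_powR; rewrite in_itv /= andbT normr_gt0.
Unshelve. all: by end_near.
Qed.

(* The absolute value makes the path continuous on the whole line, as [powR]
   is [1] at negative bases. *)
Lemma is_derive_segment_powR {R : realType} (b z r t : R) :
  0 <= b -> 0 <= z -> 0 < t < 1 ->
  is_derive t 1 (fun u => `|u * b + (1 - u) * z| `^ r)
    (r * (b - z) * (t * b + (1 - t) * z) `^ (r - 1)).
Proof.
move=> b0 z0 /andP[t0 t1].
(* At an interior [t] the combination vanishes only if [b = z = 0]; the path is then constant, and
   the factor [b - z] kills the claimed derivative. *)
have [m0|m0] := ltP 0 (t * b + (1 - t) * z); last first.
  have -> : b = 0 by nra.
  have -> : z = 0 by nra.
  rewrite subrr mulr0 mul0r (_ : (fun _ => _) = cst (0 `^ r)); first exact: is_derive_cst.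
  by apply/funext => u; rewrite !mulr0 addr0 normr0.
pose m := fun u : R => u * b + (1 - u) * z.
have dm : is_derive t 1 m (b - z).
  have -> : m = (fun u : R => (b - z) *: u + z) by apply/funext => u; rewrite /m /GRing.scale /=; ring.
  apply: is_derive_eq; rewrite addr0 /GRing.scale /= mulr1; ring.
have dp := is_derive1_powR r m0.
apply: (@near_eq_is_derive _ _ _ (fun u => m u `^ r)).
  have cm : continuous_at t m by apply: differentiable_continuous; apply/derivable1_diffP.
  near=> u; rewrite ger0_norm // ltW //.
  near: u; exact: (cvgr_gt (m t)).
apply: is_derive_eq; first exact: (@is_derive1_comp _ (fun v => v `^ r) m t).
rewrite /GRing.scale /=; ring.
Unshelve. all: by end_near.
Qed.

(** The rank-one end has zero minor, so only the minor of [C] and the mixed term in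
    [p b^2 - 2 s a b + q a^2] remain; multiplied by [p], the latter is a square plus
    [(p q - s^2) a^2]. *)
Lemma minor2_segment_gt0 {R : realFieldType} (p q s a b d c : R) :
  0 < p -> 0 < d -> 0 < c < 1 -> s ^+ 2 < p * q ->
  (c * s + (1 - c) * (a * b / d)) ^+ 2 <
  (c * p + (1 - c) * (a * a / d)) * (c * q + (1 - c) * (b * b / d)).
Proof.
move=> p0 d0 /andP[c0 c1] spq; rewrite -subr_gt0.
have -> : (c * p + (1 - c) * (a * a / d)) * (c * q + (1 - c) * (b * b / d)) -
    (c * s + (1 - c) * (a * b / d)) ^+ 2 =
    c ^+ 2 * (p * q - s ^+ 2) + c * (1 - c) / (d * p) *
      ((p * b - s * a) ^+ 2 + (p * q - s ^+ 2) * a ^+ 2).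
  by field; rewrite !gt_eqF.
apply: ltr_pwDl; first by rewrite mulr_gt0 ?exprn_gt0 // subr_gt0.
have sp0 : 0 <= p * q - s ^+ 2 by rewrite subr_ge0 ltW.
apply: mulr_ge0; last by rewrite addr_ge0 ?sqr_ge0 // mulr_ge0 ?sqr_ge0.
apply: divr_ge0; apply: mulr_ge0; lra.
Qed.

(** The induction shrinks the support [T] and keeps the index type. The sign of [r] is left free
    because the step from two indices to one lowers [r] to [r - 1 > -1], possibly negative. *)
Lemma hadamard_power_pd {R : realType} {I : finType} (T : {set I}) (C : I -> I -> R) (r : R) :
  psd_kernel C -> (forall i j, 0 <= C i j) -> (forall i, i \in T -> 0 < C i i) ->
  (forall i j, i \in T -> j \in T -> i != j -> C i j ^+ 2 < C i i * C j j) ->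
  #|T|%:R - 2 < r ->
  forall x, (forall i, i \notin T -> x i = 0) -> (exists i, x i != 0) ->
  0 < qform (fun i j => C i j `^ r) x.
Proof.
have [n] := ubnP #|T|; elim: n T C r => // n IHn T C r Tn pC C0 Cd Cm hr x xT [k xk].
have sC := pC.1.
have kT : k \in T by apply: contraNT xk => /xT ->.
have dk := Cd k kT.
have dk' : C k k != 0 by rewrite gt_eqF.
have [[i [ik xi]]|/forallNP xk0] := pselect (exists i, i != k /\ x i != 0); last first.
  rewrite (_ : x = fun l => 0 + x k * (l == k)%:R); last first.
    apply/funext => l; have [->|lk] := eqVneq l k; first by rewrite add0r mulr1.
    rewrite mulr0 addr0; apply/eqP/negPn/negP => xl; exact: (xk0 l).
  rewrite (qform_shift _ (fun=> 0)) => [|? ?]; last by rewrite sC.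
  rewrite qform0 big1 => [|l _]; last by rewrite mul0r.
  by rewrite mulr0 !add0r mulr_gt0 ?powR_gt0 // lt_def sqr_ge0 sqrf_eq0 xk.
have iT : i \in T by apply: contraNT xi => /xT ->.
have Tk : #|T| = #|T :\ k|.+1 by rewrite (cardsD1 k) kT.
have ik' : i \in T :\ k by rewrite !inE ik iT.
have Tk0 : (0 < #|T :\ k|)%N by apply/card_gt0P; exists i.
(* [T] contains both [i] and [k], so the bound on [r] is at least 0. Positivity gives continuity of
   the path at the endpoints, where entries may vanish. *)
have r0 : 0 < r.
  apply: le_lt_trans hr; rewrite Tk -natr1 -(ler_nat R) in Tk0 *; lra.
pose z i j := C i k * C j k / C k k.
pose F (u : R) := \sum_i \sum_j (x i * x j) *: `|u * C i j + (1 - u) * z i j| `^ r.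
pose dF (u : R) := \sum_i \sum_j (x i * x j) *:
  (r * (C i j - z i j) * (u * C i j + (1 - u) * z i j) `^ (r - 1)).
have z0 a b : 0 <= z a b by rewrite divr_ge0 ?mulr_ge0.
have [||c] := @MVT R F dF 0 1 ltr01.
- move=> u; rewrite in_itv /= => u01.
  apply: is_derive_bigsum => a; apply: is_derive_bigsum => b.
  have dab := is_derive_segment_powR _ _ r _ (C0 a b) (z0 a b) u01.
  exact: is_deriveZ.
- apply: continuous_subspaceT => u.
  do 2 (apply: cvg_big => [|? _]; first exact: add_continuous).
  apply: cvgZl_tmp.
  apply: (continuous_comp (f := fun u : R => u * _ + (1 - u) * _)
           (g := fun v : R => `|v| `^ r)); last exact: norm_powR_continuous.
  by apply: differentiable_continuous; apply/derivable1_diffP.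
rewrite in_itv /= subr0 mulr1 => c01 e.
have -> : qform (fun i j => C i j `^ r) x = F 1.
  by do 2 (apply: eq_bigr => ? _); rewrite subrr mul0r addr0 mul1r ger0_norm.
have F0 : 0 <= F 0.
  have -> : F 0 = (C k k)^-1 `^ r * (\sum_i x i * C i k `^ r) ^+ 2.
    rewrite expr2 big_distrlr mulr_sumr; apply: eq_bigr => a _.
    rewrite mulr_sumr; apply: eq_bigr => b _.
    rewrite mul0r add0r subr0 mul1r ger0_norm // /z.
    rewrite !powRM ?mulr_ge0 ?invr_ge0 ?(ltW dk) // /GRing.scale /=; ring.
  by rewrite mulr_ge0 ?powR_ge0 ?sqr_ge0.
suff : 0 < dF c by lra.
pose M a b := c * C a b + (1 - c) * z a b.
(* Erasing coordinate [k] does not change the form, as row [k] of the Schur complement is zero, and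
   it puts the support inside [T :\ k]. *)
pose y l := if l == k then 0 else x l.
have -> : dF c = r * qform (fun a b => schur k C a b * M a b `^ (r - 1)) y.
  rewrite mulr_sumr; apply: eq_bigr => a _; rewrite mulr_sumr; apply: eq_bigr => b _.
  rewrite /GRing.scale /= -/(M a b) -/(schur k C a b) /y.
  have [->|ak] := eqVneq a k; first by rewrite schur_row0 //; ring.
  have [->|bk] := eqVneq b k; last by ring.
  by rewrite (psd_schur _ _ pC dk').1 schur_row0 //; ring.
have [c0 c1] := andP c01.
have c0w := ltW c0; have c1w : 0 <= 1 - c by rewrite subr_ge0 ltW.
rewrite mulr_gt0 //; apply: (@schur_product_gt0 _ _ (T :\ k)).
- exact: psd_schur.
- have MT := minor2_segment_gt0 _ _ _ _ _ _ _ _ dk c01.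
  apply: IHn.
  + by rewrite Tk in Tn.
  + split=> [a b|v]; first by rewrite /M /z sC [C a k * _]mulrC.
    have -> : qform M v = c * qform C v + (1 - c) * ((\sum_i v i * C i k) ^+ 2 / C k k).
      rewrite expr2 big_distrlr /= mulr_suml !mulr_sumr -big_split; apply: eq_bigr => a _.
      rewrite mulr_suml !mulr_sumr -big_split; apply: eq_bigr => b _.
      rewrite /M /z /=; ring.
    by rewrite addr_ge0 // mulr_ge0 ?(pC.2) ?divr_ge0 ?sqr_ge0 ?(ltW dk).
  + by move=> a b; rewrite addr_ge0 // mulr_ge0.
  + move=> a /setD1P[_ aT]; apply: ltr_pwDl; first by rewrite mulr_gt0 ?Cd.
    by rewrite mulr_ge0.
  + by move=> a b /setD1P[_ aT] /setD1P[_ bT] ab; apply: MT; [exact: Cd|exact: Cm].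
  + rewrite Tk -natr1 in hr; lra.
- move=> l; rewrite /y !inE; case: eqP => //= _; exact: xT.
(* The strict minor on [i] and [k] makes the diagonal entry of the Schur complement at [i]
   positive. *)
- exists i; rewrite /y (negbTE ik); split=> //.
  by rewrite /schur subr_gt0 ltr_pdivrMr // -expr2; apply: Cm.
Qed.

(** * Proportional columns and the rank *)

Lemma psdmx_kernel {R : realType} {n : nat} (A : 'M[R]_n) :
  psdmx A -> psd_kernel (fun i j => A i j).
Proof.
move=> [/is_hermitianmxP sA pA]; split=> [i j|x].
  by rewrite {1}sA !mxE /= expr0 mul1r.
have := pA (\col_i x i); congr (_ <= _).
rewrite mxE [RHS]exchange_big /=; apply: eq_bigr => j _.
rewrite !mxE mulr_suml; apply: eq_bigr => i _; rewrite !mxE; ring.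
Qed.

(** If the minor vanished, so would the Schur complement's diagonal entry at [i], hence its whole
    column [i], making column [i] of [A] a multiple of column [j]. *)
Lemma psd_minor2_gt0 {R : realType} {n : nat} (A : 'M[R]_n) i j :
  psd_kernel (fun i j => A i j) -> 0 < A j j ->
  ~ scalar_multiple (col i A) (col j A) -> A i j ^+ 2 < A i i * A j j.
Proof.
move=> pA dj nm; have dj0 : A j j != 0 by rewrite gt_eqF.
have pS := psd_schur _ j pA dj0.
have := psd_diag_ge0 _ pS i; rewrite le_eqVlt => /orP[/eqP/esym S0|]; last first.
  by rewrite /schur subr_gt0 ltr_pdivrMr // expr2.
case: nm; exists (A i j / A j j).
apply/matrixP => m k; rewrite !mxE; apply/eqP; rewrite -subr_eq0; apply/eqP.
have := psd_diag0 _ pS i m S0; rewrite /schur => <-; ring.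
Qed.

Lemma Hrk_generators {R : realType} {m n : nat} (A : 'M[R]_(m, n)) :
  A != 0 -> (forall i j, 0 <= A i j) ->
  exists S : {set 'I_n}, [/\ #|S| = Hrk A, pairwise_nonmultiple_cols A S,
    forall i, i \in S -> col i A != 0 &
    forall j, exists ic : 'I_n * R,
      [/\ ic.1 \in S, 0 <= ic.2 & col j A = ic.2 *: col ic.1 A]].
Proof.
move=> A0 Age0; rewrite /Hrk (negbTE A0).
pose P (S : {set 'I_n}) := `[< pairwise_nonmultiple_cols A S >].
have [k ck] : exists k, col k A != 0.
  apply/existsP; apply: contraNT A0; rewrite negb_exists => /forallP c0.
  apply/eqP/matrixP => i j; have := c0 j; rewrite negbK => /eqP/matrixP/(_ i 0).
  by rewrite !mxE.
have Pk : P [set k].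
  by apply/asboolP => i j /set1P -> /set1P ->; rewrite eqxx.
have Smax S : P S -> (#|S| <= \max_(S | P S) #|S|)%N by move=> ?; apply: leq_bigmax_cond.
(* A zero column is a multiple of any other, so it can occur only in a set of one index; such a set
   is replaced by [[set k]]. *)
have [S [cS PS Snz]] : exists S : {set 'I_n}, [/\ #|S| = \max_(S | P S) #|S|, P S &
    forall i, i \in S -> col i A != 0].
  have [|S0 PS0 eS0] := @eq_bigmax_cond _ P (fun S => #|S|).
    by apply/card_gt0P; exists [set k].
  have [S1|S1] := leqP #|S0| 1.
    exists [set k]; split=> // [|i /set1P -> //].
    by apply/anti_leq; rewrite Smax //= eS0 cards1.
  exists S0; split=> // i iS; apply/eqP => ci0.
  move: S1; rewrite (cardsD1 i) iS => /card_gt0P[j /setD1P[ji jS]].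
  move/asboolP: PS0 => /(_ i j iS jS); rewrite eq_sym; apply => //.
  by exists 0; rewrite ci0 scale0r.
exists S; split=> // [|j]; first exact/asboolP.
suff [i [iS [c e]]] : exists i, i \in S /\ scalar_multiple (col j A) (col i A).
  exists (i, c); split=> //=.
  have [l Al] : exists l, A l i != 0.
    apply/existsP; apply: contraNT (Snz i iS); rewrite negb_exists => /forallP c0.
    apply/eqP/matrixP => l o; rewrite !mxE; apply/eqP; have := c0 l; by rewrite negbK.
  move/matrixP/(_ l 0): e; rewrite !mxE => e.
  by have := Age0 l j; rewrite e pmulr_lge0 // lt_def Al Age0.
have [jS|jS] := boolP (j \in S); first by exists j; split=> //; exists 1; rewrite scale1r.
apply/not_existsP => nex.
(* Otherwise [j] could be added to [S], against maximality; a relation in the reverse direction is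
   inverted, its factor being nonzero. *)
have : P (j |: S).
  apply/asboolP => a b /setU1P[->|aS] /setU1P[->|bS]; rewrite ?eqxx // => ab.
  - by move=> sm; apply: (nex b).
  - move=> [c e]; apply: (nex a); split=> //; exists c^-1.
    rewrite e scalerA mulVf ?scale1r //; apply: contraNneq (Snz a aS) => c0.
    by rewrite e c0 scale0r.
  - by move/asboolP: PS; apply.
by move/Smax; rewrite -cS cardsU1 jS ltnn.
Qed.

(** Powers preserve proportionality, [(c a)^r = c^r a^r] for nonnegative [c] and [a], so the power
    factors through its columns in [S]. *)
Lemma rank_le_generators {R : realType} {m n : nat} (A : 'M[R]_(m, n)) (r : R) (S : {set 'I_n}) :
  (forall i j, 0 <= A i j) ->
  (forall j, exists ic : 'I_n * R,
      [/\ ic.1 \in S, 0 <= ic.2 & col j A = ic.2 *: col ic.1 A]) ->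
  (\rank (hadamard_power r A) <= #|S|)%N.
Proof.
move=> A0 /choice[g gP].
pose D : 'M[R]_(#|S|, n) := \matrix_(l, j) ((enum_val l == (g j).1)%:R * (g j).2 `^ r).
suff -> : hadamard_power r A = colsub (@enum_val _ (mem S)) (hadamard_power r A) *m D.
  exact: mulmx_max_rank.
apply/matrixP => i j; rewrite !mxE; have [gS c0 e] := gP j.
rewrite (bigD1 (enum_rank_in gS (g j).1)) //= big1 => [|l ne]; last first.
  rewrite !mxE; case: eqP => [el|]; last by rewrite mul0r mulr0.
  by case/eqP: ne; apply: enum_val_inj; rewrite enum_rankK_in.
rewrite !mxE enum_rankK_in // eqxx mul1r addr0.
move/matrixP/(_ i 0): e; rewrite !mxE => ->.
by rewrite powRM // mulrC.
Qed.

Theorem theorem1 (R : realType) (n : nat) (A : 'M[R]_n) (r : R)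
    (hA0 : A != 0) (hA : doubly_nonnegative A) (hr0 : 0 < r)
    (hr : (Hrk A)%:R - 2 < r) :
  \rank (hadamard_power r A) = Hrk A.
Proof.
have [/psdmx_kernel pA A0] := hA.
have [S [cS PS Snz gen]] := Hrk_generators A hA0 A0.
apply/anti_leq; rewrite -cS rank_le_generators //=.
pose f := @enum_val _ (mem S); pose H := hadamard_power r A.
suff : row_free (rowsub f H) by rewrite -row_leq_rank => /leq_trans; apply; exact/mxrankS/rowsub_sub.
rewrite -kermx_eq0; apply/eqP/row_matrixP => l0; rewrite row0.
set v := row l0 _.
have vH : v *m rowsub f H = 0 by apply/sub_kermxP; exact: row_sub.
apply/eqP/negPn/negP => v0.
(* [x] extends the kernel vector [v] by zero outside [S]; its form is then both positive and
   zero. *)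
pose x i := \sum_l (f l == i)%:R * v 0 l.
have xf l : x (f l) = v 0 l.
  rewrite /x (bigD1 l) //= eqxx mul1r big1 ?addr0 // => o ol.
  by rewrite (inj_eq enum_val_inj) (negbTE ol) mul0r.
have dS i : i \in S -> 0 < A i i.
  move=> /Snz ci; rewrite lt_def A0 andbT; apply: contraNneq ci => d0.
  by apply/eqP/matrixP => a b; rewrite !mxE; apply: psd_diag0 pA _ _ d0.
have sumx F : \sum_i x i * F i = \sum_l v 0 l * F (f l).
  under eq_bigr do rewrite mulr_suml; rewrite exchange_big; apply: eq_bigr => l _.
  rewrite -[RHS](sum_delta (f l) (fun i => v 0 l * F i)); apply: eq_bigr => i _.
  by rewrite mulrA eq_sym.
have : 0 < qform (fun i j => A i j `^ r) x.
  apply: (hadamard_power_pd S _ _ pA A0 dS).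
  - move=> i j iS jS ij; apply: psd_minor2_gt0 => //; [exact: dS|exact: PS].
  - by rewrite cS.
  - move=> i iS; rewrite /x big1 // => l _; case: eqP => [e|]; last by rewrite mul0r.
    by rewrite -e enum_valP in iS.
  - have [l vl] : exists l, v 0 l != 0.
      apply/existsP; apply: contraNT v0; rewrite negb_exists => /forallP c0.
      by apply/eqP/rowP => l; have := c0 l; rewrite negbK [RHS]mxE => /eqP.
    by exists (f l); rewrite xf.
rewrite (_ : qform _ x = 0) ?ltxx // /qform exchange_big big1 //= => j _.
under eq_bigr do rewrite -mulrA.
have /matrixP/(_ 0 j) := vH; rewrite sumx !mxE => vHj.
transitivity ((\sum_l v 0 l * rowsub f H l j) * x j); last by rewrite vHj mul0r.
rewrite mulr_suml; apply: eq_bigr => l _; rewrite !mxE; ring.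
Qed.
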